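(* Sheu's compact support condition $$\int^\infty\frac{1}{\sqrt{\int_{\lambda^*}^\lambda\psi(\theta)\,d\theta}}\,d\lambda<\infty$$ is Grey's condition for the limiting standard continuous-state branching process $Z^\infty$ with branching mechanism $\Psi_\infty$; that is, it holds if and only if $$\int^\infty\frac{1}{\Psi_\infty(\theta)}\,d\theta<\infty.$$
   Context: Branching mechanism. Let $d\ge1$ and $$\psi(\lambda)=-\alpha\lambda+\beta\lambda^2+\int_{(0,\infty)}(e^{-\lambda x}-1+\lambda x)\,\Pi(dx),\quad \lambda\ge0,$$ where $\alpha=-\psi'(0+)\in(-\infty,\infty)$, $\beta\ge0$ and $\Pi$ is a measure concentrated on $(0,\infty)$ with $\int_{(0,\infty)}(x\wedge x^2)\Pi(dx)<\infty$. Assume $\psi(\infty)=\infty$. $\psi$ is (sub)critical if $\psi'(0+)\ge0$ and supercritical if $\psi'(0+)<0$. Put $\lambda^*:=\inf\{\lambda\ge0:\psi(\lambda)>0\}$, which is finite; $\lambda^*=0$ in the (sub)critical case and $\lambda^*>0$ in the supercritical case. The notation $\int^\infty$ means integration over $[c,\infty)$ for sufficiently large $c$. Let $X$ be a super-Brownian motion in $\mathbb{R}^d$ with branching mechanism $\psi$, let $D_s$ be the open ball of radius $s$ about the origin, and let $Z_s=\|X_{D_s}\|$, $s\ge r$, be the total mass of Dynkin's exit measure $X_{D_s}$ (mass of $X$ frozen when first hitting $\partial D_s$), with $X$ started from a finite measure on $\partial D_r$ of mass $a$ (law $P_{a,r}$). $Z$ is a time-inhomogeneous continuous-state branching process with $E_{a,r}[e^{-\theta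 Z_s}]=e^{-u(r,s,\theta)a}$, $u(r,s,\theta)=\theta-\int_r^s\Psi(z,u(z,s,\theta))\,dz$, where $(\Psi(r,\cdot),r>0)$ is its family of branching mechanisms. $\Psi_\infty(\theta):=\lim_{r\to\infty}\Psi(r,\theta)$ is the limiting branching mechanism, given by $$\Psi_\infty(\theta)=2\operatorname{sgn}(\psi(\theta))\sqrt{\int_{\lambda^*}^\theta\psi(\lambda)\,d\lambda}$$ (with the sign taken as $-1$ at $\theta=0$ in the supercritical case), and $Z^\infty$ is the standard (time-homogeneous) continuous-state branching process with branching mechanism $\Psi_\infty$. Grey's condition for a standard continuous-state branching process with branching mechanism $F$ is $\int^\infty F(\theta)^{-1}\,d\theta<\infty$. *)

(* Defs.v *)
From HB Require Import structures.
From mathcomp Require Import all_boot all_order all_algebra.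
From mathcomp Require Import all_classical all_reals all_analysis.

Set Implicit Arguments.
Unset Strict Implicit.
Unset Printing Implicit Defensive.

Import Order.TTheory GRing.Theory Num.Theory.
Import numFieldNormedType.Exports.
Local Open Scope classical_set_scope.
Local Open Scope ring_scope.

Section Defs.
Variable R : realType.
Local Notation mu := (@lebesgue_measure R).

(* The condition on the jump measure makes the integrand below Pi-integrable,
   so that the real-valued integral carries no junk value. *)
Definition is_jump_measure
    (Pi : {measure set (measurableTypeR R) -> \bar R}) : Prop :=
  Pi (~` `]0, +oo[) = 0%E /\
  (\int[Pi]_(x in `]0%R, +oo[) (Num.min x (x ^+ 2))%:E < +oo)%E.

(* Only the values at lambda >= 0 are meaningful. *)
Definition branching_mechanism (alpha beta : R)
    (Pi : {measure set (measurableTypeR R) -> \bar R}) (lambda : R) : R :=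
  - alpha * lambda + beta * lambda ^+ 2
  + Rintegral Pi `]0, +oo[ (fun x => expR (- lambda * x) - 1 + lambda * x).

Definition lambda_star (psi : R -> R) : R :=
  inf [set lambda : R | 0 <= lambda /\ 0 < psi lambda].

Definition supercritical (psi : R -> R) : Prop :=
  lim (derive1 psi x @[x --> 0^'+]) < 0.

(* Oriented integral from a to b; b < a is needed because the limiting
   mechanism is also defined at theta < lambda_star psi. *)
Definition oriented_integral (a b : R) (f : R -> R) : R :=
  if a <= b then Rintegral mu `[a, b] f else - Rintegral mu `[b, a] f.

(* At theta = 0 in the supercritical case psi 0 = 0, but the sign is -1 by
   convention. *)
Definition sgn_psi (psi : R -> R) (theta : R) : R :=
  if `[< theta = 0 /\ supercritical psi >] then -1 else Num.sg (psi theta).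

Definition limiting_mechanism (psi : R -> R) (theta : R) : R :=
  2 * sgn_psi psi theta
  * Num.sqrt (oriented_integral (lambda_star psi) theta psi).

(* Finiteness of the integral of f over [c, +oo[ for sufficiently large c. *)
Definition integral_at_infty_finite (f : R -> R) : Prop :=
  \forall c \near +oo, (\int[mu]_(x in `[c, +oo[) (f x)%:E < +oo)%E.

Definition grey_condition (F : R -> R) : Prop :=
  integral_at_infty_finite (fun theta => (F theta)^-1).

Definition sheu_condition (psi : R -> R) : Prop :=
  integral_at_infty_finite (fun lambda =>
    1 / Num.sqrt (oriented_integral (lambda_star psi) lambda psi)).

End Defs.

(* Main.v *)
Require Import Defs.
From HB Require Import structures.
From mathcomp Require Import all_boot all_order all_algebra.
From mathcomp Require Import all_classical all_reals all_analysis.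
Import Order.TTheory GRing.Theory Num.Theory.
Import numFieldNormedType.Exports.
Local Open Scope classical_set_scope.
Local Open Scope ring_scope.

(** As [psi] tends to +oo, it is positive at all large arguments, so there the sign in
    [limiting_mechanism] is 1 and the Grey integrand is exactly half the Sheu integrand. By
    [integral_at_infty_finiteZ], a positive constant factor does not change finiteness. *)

(* [ge0_integralZl] requires measurability. Here the integral is instead
   unfolded as a supremum over simple functions, so that the measurability of
   [psi] and of its primitive never matters. *)
Lemma ge0_integralZl_ge d (T : measurableType d) (R : realType)
    (mu : {measure set T -> \bar R}) (D : set T) (f : T -> \bar R) (k : R) :
  0 < k -> (forall x, D x -> (0 <= f x)%E) ->
  (k%:E * \int[mu]_(x in D) f x <= \int[mu]_(x in D) (k%:E * f x))%E.
Proof.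
move=> k0 f0; have kE0 : (0 <= k%:E)%E by rewrite lee_fin ltW.
rewrite muleC -lee_pdivlMr//.
rewrite !ge0_integralE//; last by move=> x Dx; rewrite mule_ge0// f0.
(* A simple [h] below [f] yields the competitor [k * h] below [k * f]. *)
apply: ge_ereal_sup => _ [h /= hf <-]; rewrite lee_pdivlMr// muleC -sintegralrM.
apply: ereal_sup_ubound; exists (scale_nnsfun h (ltW k0)) => //= x.
rewrite EFinM; apply: (@le_trans _ _ (k%:E * (f \_ D) x)%E).
  exact: lee_wpmul2l.
by rewrite /patch; case: ifP; rewrite ?mule0.
Qed.

Lemma ge0_integralZl_lty d (T : measurableType d) (R : realType)
    (mu : {measure set T -> \bar R}) (D : set T) (f : T -> R) (k : R) :
  0 < k -> (forall x, D x -> 0 <= f x) ->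
  (\int[mu]_(x in D) (k * f x)%:E < +oo)%E ->
  (\int[mu]_(x in D) (f x)%:E < +oo)%E.
Proof.
move=> k0 f0 kfoo.
have := @ge0_integralZl_ge _ _ _ mu D (EFin \o f) _ k0.
move=> /(_ f0)/le_lt_trans/(_ kfoo).
have : (0 <= \int[mu]_(x in D) (EFin \o f) x)%E by exact: integral_ge0.
(* The value +oo is excluded because [k * +oo = +oo]. *)
by case: integral => [r|_|//]; rewrite ?ltry// gt0_muley.
Qed.

(** The one-sided scaling bound suffices: it is applied with [k] in one direction and with [k^-1] in
    the other. *)
Lemma integral_at_infty_finiteZ (R : realType) (f g : R -> R) (k : R) :
  0 < k -> (forall x, 0 <= g x) -> (\forall x \near +oo, f x = k * g x) ->
  integral_at_infty_finite f <-> integral_at_infty_finite g.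
Proof.
move=> k0 g0 [M [Mreal fE]].
have fgE c : M < c -> (\int[lebesgue_measure]_(x in `[c, +oo[) (f x)%:E =
    \int[lebesgue_measure]_(x in `[c, +oo[) (k * g x)%:E)%E.
  move=> Mc; apply: eq_integral => x; rewrite inE/= in_itv/= andbT => cx.
  by rewrite fE//; exact: lt_le_trans cx.
split=> H; near=> c.
all: have Mc : M < c by near: c; exact: nbhs_pinfty_gt.
- by apply: (@ge0_integralZl_lty _ _ _ _ _ _ k) => //; rewrite -fgE//; near: c.
- rewrite fgE//; apply: (@ge0_integralZl_lty _ _ _ _ _ _ k^-1).
  + by rewrite invr_gt0.
  + by move=> x _; rewrite mulr_ge0// ltW.
  + by under eq_integral do rewrite mulKf ?gt_eqF//; near: c.
Unshelve. all: by end_near. Qed.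

Theorem corollary4 (R : realType) (alpha beta : R)
    (Pi : {measure set (measurableTypeR R) -> \bar R})
    (hbeta : 0 <= beta) (hPi : is_jump_measure Pi)
    (hinfty : branching_mechanism alpha beta Pi lambda
                @[lambda --> +oo] --> +oo) :
  let psi := branching_mechanism alpha beta Pi in
  sheu_condition psi <-> grey_condition (limiting_mechanism psi).
Proof.
move=> psi; apply: iff_sym.
apply: (@integral_at_infty_finiteZ _ _ _ 2^-1); first by rewrite invr_gt0.
  by move=> x; rewrite divr_ge0// sqrtr_ge0.
near=> x.
have x0 : 0 < x by near: x; exact: nbhs_pinfty_gt.
have psi0 : 0 < psi x by near: x; exact: cvgry_gt.
(* Since [0 < x], the special sign convention at 0 does not apply. *)
rewrite /limiting_mechanism /sgn_psi asboolF; last first.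
  by case=> xE _; move: x0; rewrite xE ltxx.
by rewrite gtr0_sg// mulr1 invfM div1r.
Unshelve. all: by end_near. Qed.
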